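(* Let $q$ be a prime power and let $n,i,d \ge 1$ be integers with $i \le n$. Suppose $n \ge id$. Then \begin{multline*} w_i(q,n,d) \ = \ (-1)^i (q-1)^{i(d-1)} \sum_{1 \le \ell_1< \ell_2 < \cdots < \ell_i \le n-d+1} \left( \prod_{j=1}^i \binom{n-\ell_j-d(i-j)}{d-1} \right) \\ + \sum_{t=i}^{id-1} \binom{n}{t} w_i(q,t,d)\sum_{s=t}^{id-1} \binom{n-t}{n-s} (-1)^{s-t}. \end{multline*}
   Context: The Hamming weight of $v \in \mathbb{F}_q^n$ is the number of its nonzero coordinates. For integers $n,d\ge 1$, the higher-weight Dowling lattice $\mathcal{H}(q,n,d)$ is the set, ordered by inclusion, of all $\mathbb{F}_q$-linear subspaces of $\mathbb{F}_q^n$ that have a basis made of vectors of Hamming weight at most $d$, together with the zero space. It is a finite geometric lattice whose rank function is the $\mathbb{F}_q$-dimension. With $\mu$ the Möbius function of $\mathcal{H}(q,n,d)$, the $i$-th Whitney number (of the first kind) is $w_i(q,n,d)=\sum_{U \in \mathcal{H}(q,n,d),\ \dim U=i} \mu(\{0\},U)$ (an empty sum is $0$). Conventions: sums over empty index sets are $0$, and $\binom{x}{y}=0$ for integers $x<y$ with $y\ge 0$ (including negative $x$). *)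

(* Defs.v *)
From HB Require Import structures.
From mathcomp Require Import all_boot all_order all_algebra.

Set Implicit Arguments.
Unset Strict Implicit.
Unset Printing Implicit Defensive.

Import Order.TTheory GRing.Theory Num.Theory.
Local Open Scope ring_scope.

(* The Moebius function of a finite poset, by the usual recursion
   mu(x, x) = 1 and mu(x, y) = - \sum_(x <= z < y) mu(x, z) if x < y,
   extended by 0 to the pairs with not x <= y.  The fuel k is the length of
   the recursion; #|T| is always enough, see mobius_lt. *)
Section Mobius.
Context {disp : Order.disp_t} {T : finPOrderType disp}.
Implicit Types x y z : T.

Fixpoint mobius_rec (k : nat) x y : int :=
  if k is k'.+1 then
    if x == y then 1
    else if (x < y)%O then - \sum_(z : T | (x <= z < y)%O) mobius_rec k' x z
    else 0
  else 0.

Definition mobius x y : int := mobius_rec #|T| x y.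

Let height y := #|[pred z | (z < y)%O]|.

Let height_mono z y : (z < y)%O -> (height z < height y)%N.
Proof.
move=> lt_zy; apply/proper_card/properP; split.
  by apply/subsetP => u; rewrite !inE => /lt_trans; apply.
by exists z; rewrite !inE ?ltxx.
Qed.

Let height_card y : (height y < #|T|)%N.
Proof.
rewrite /height -[#|T|](cardC (pred1 y)) card1 add1n ltnS.
by apply/subset_leq_card/subsetP => u; rewrite !inE => /lt_eqF ->.
Qed.

Let mobius_rec_fuel k l x y :
  (height y < k)%N -> (height y < l)%N -> mobius_rec k x y = mobius_rec l x y.
Proof.
elim: k l y => [|k IHk] [|l] y //=; rewrite !ltnS => hk hl.
case: ifP => // _; case: ifP => // _; congr (- _).
apply: eq_bigr => z /andP[_ /height_mono hz].
by apply: IHk; apply: leq_trans hz _.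
Qed.

Lemma mobius_xx x : mobius x x = 1.
Proof.
by rewrite /mobius; case: #|T| (height_card x) => //= k _; rewrite eqxx.
Qed.

Lemma mobius_lt x y :
  (x < y)%O -> mobius x y = - \sum_(z : T | (x <= z < y)%O) mobius x z.
Proof.
move=> lt_xy; have := height_card y; rewrite /mobius.
case Ek: #|T| => [//|k] hy /=; rewrite (lt_eqF lt_xy) lt_xy; congr (- _).
apply: eq_bigr => z /andP[_ /height_mono hz].
apply: (@mobius_rec_fuel k k.+1).
  by apply: leq_trans hz _; rewrite -ltnS.
by apply: leq_trans hz _; apply: ltnW.
Qed.

Lemma mobius_nle x y : ~~ (x <= y)%O -> mobius x y = 0.
Proof.
rewrite /mobius le_eqVlt negb_or => /andP[/negbTE xy /negbTE lt_xy].
by case: #|T| => //= k; rewrite xy lt_xy.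
Qed.

End Mobius.

Section FiniteVspace.
Import VectorInternalTheory.
Variables (F : finFieldType) (vT : vectType F).

HB.instance Definition _ := [Countable of {vspace vT} by <:].
HB.instance Definition _ := [Finite of {vspace vT} by <:].

End FiniteVspace.

Section HigherWeightDowling.
Variables (F : finFieldType) (n d : nat).

Definition hweight (v : 'rV[F]_n) : nat := #|[set k : 'I_n | v 0 k != 0]|.

Definition low_weight_basis (U : {vspace 'rV[F]_n}) : bool :=
  [exists X : (\dim U).-tuple 'rV[F]_n,
     basis_of U X && all (fun v => hweight v <= d)%N X].

Record dowling : predArgType := Dowling {
  dowling_val :> {vspace 'rV[F]_n};
  _ : (dowling_val == 0%VS) || low_weight_basis dowling_val
}.

HB.instance Definition _ := [isSub of dowling for dowling_val].
HB.instance Definition _ := [Finite of dowling by <:].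

Definition dowling_le (U V : dowling) : bool :=
  (dowling_val U <= dowling_val V)%VS.

Fact dowling_le_refl : reflexive dowling_le.
Proof. by move=> U; apply: subvv. Qed.

Fact dowling_le_anti : antisymmetric dowling_le.
Proof. by move=> U V UV; apply/val_inj/eqP; rewrite eqEsubv. Qed.

Fact dowling_le_trans : transitive dowling_le.
Proof. by move=> V U W; apply: subv_trans. Qed.

Fact dowling_display : Order.disp_t. Proof. exact: Order.Disp tt tt. Qed.

HB.instance Definition _ := Order.Le_isPOrder.Build dowling_display dowling
  dowling_le_refl dowling_le_anti dowling_le_trans.

Fact dowling0_subproof :
  ((0%VS : {vspace 'rV[F]_n}) == 0%VS) || low_weight_basis 0%VS.
Proof. by rewrite eqxx. Qed.

Definition dowling0 : dowling := Dowling dowling0_subproof.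

Definition whitney (i : nat) : int :=
  \sum_(U : dowling | \dim U == i) mobius dowling0 U.

End HigherWeightDowling.

(* 'C(x, y) for x : int, with the convention that it is 0 for x < 0. *)
Definition binz (x : int) (y : nat) : nat :=
  if x is Posz m then 'C(m, y) else 0%N.

(* Main.v *)
Require Import Defs.
From HB Require Import structures.
From mathcomp Require Import all_boot all_order all_algebra.
From mathcomp Require Import zify ring.
Set Implicit Arguments.
Unset Strict Implicit.
Unset Printing Implicit Defensive.
Import Order.TTheory GRing.Theory Num.Theory.

(** The subspaces U of rank i are sorted by the size u of their support, the
    set of coordinates on which some vector of U does not vanish. Let g(u)
    be the sum of mu(0, U) over the U of rank i with support of size u
    ([whitney_supp]). A basis of i vectors of weight at most d shows that
    g(u) = 0 for u > id, so w_i(n) is the sum of the g(u) with u < id, plus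
    g(id).

    Below id. The interval [0, U] only involves vectors supported in the
    support of U. Hence for a set S of t coordinates, the U supported in S
    contribute w_i(t) to w_i(n) ([whitney_restrict]); summing over all S of
    size t gives C(n, t) w_i(t) = sum over u of C(n - u, n - t) g(u)
    ([bin_whitney]). Binomial inversion ([bin_inversion]) turns this into
    the second term of the formula, which is the sum of the g(s) with s < id
    ([whitney_low_part]).

    At id. A U with support of size id has a basis of i vectors of weight
    exactly d with pairwise disjoint supports, a frame. A nonzero vector of
    weight at most d in the span of a frame is a multiple of one of its
    elements ([frame_low]). So the elements of the lattice below U
    correspond to the subsets of the frame, and mu(0, U) = (-1)^i
    ([mobius_framed]). It remains to count the spans of frames. Ordered
    frames are counted by adding one vector at a time ([card_tuples]):
    choosing d fresh coordinates and d nonzero entries gives the product of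
    the C(n - kd, d) (q - 1)^d for k < i, and each subspace has i! (q - 1)^i
    frames.

    Finally, the product of the C(n - kd, d) is i! times the number of
    families of i disjoint d-subsets of an n-set, and the sum over the
    chains l_1 < ... < l_i counts these families by the minima of their
    blocks: once the blocks with larger minima are removed, C(n - l_j - d(i
    - j), d - 1) ways remain to complete the block of minimum l_j.
    [chain_sum_draws] proves this by telescoping on the lower bound of the
    chain. *)

(** * Ordered families of disjoint blocks and chains of their minima *)

(** The number of ordered families of i disjoint d-subsets of an m-set. *)
Definition ordered_draws d m i := (\prod_(k < i) 'C(m - k * d, d))%N.

Lemma ordered_draws_fact d m i : (i * d <= m)%N ->
  (ordered_draws d m i * d`! ^ i * (m - i * d)`! = m`!)%N.
Proof.
elim: i => [|i IHi] hm; first by rewrite /ordered_draws big_ord0 mul0n subn0 !mul1n.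
rewrite -IHi; last by apply: leq_trans hm; rewrite mulSn leq_addl.
have hd : (d <= m - i * d)%N.
  by rewrite leq_subRL ?(leq_trans _ hm) ?mulSn ?leq_addl // addnC.
rewrite /ordered_draws big_ord_recr /= -(bin_fact hd) expnSr -subnDA -mulSnr.
ring.
Qed.

Lemma ordered_draws_small d m i : (m < i * d)%N -> ordered_draws d m i = 0%N.
Proof.
case: i => [|i] // hm; rewrite /ordered_draws big_ord_recr /= bin_small ?muln0 //.
by have := hm; rewrite mulSn; lia.
Qed.

(** Recursion on the first point of the ground set: either no block contains
    it, or it lies in one of the i.+1 blocks, and then the other blocks are
    drawn from the remaining m points before the d other points of that
    block. In the numerical proof, both sides are multiplied by the
    denominator of the multinomial coefficient, and, when the blocks fit,
    the recursion becomes m.+1 = r + i.+1 * d.+1, with r the number of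
    points outside the blocks. *)
Lemma ordered_drawsS d m i :
  ordered_draws d.+1 m.+1 i.+1
  = (ordered_draws d.+1 m i.+1
     + i.+1 * ('C(m - i * d.+1, d) * ordered_draws d.+1 m i))%N.
Proof.
set D := d.+1; case: (ltnP m (i * D)) => [lt_im | le_mi].
  rewrite (ordered_draws_small lt_im) !muln0 addn0 !ordered_draws_small //;
    by move: lt_im; rewrite mulSn /D; lia.
case: (ltnP m.+1 (i.+1 * D)) => [lt_Sim | le_iSm].
  rewrite (ordered_draws_small lt_Sim) ordered_draws_small; last exact: ltnW.
  by rewrite bin_small ?muln0 //; move: lt_Sim; rewrite mulSn /D; lia.
have hd : (d <= m - i * D)%N.
  by move: le_iSm; rewrite mulSn /D; lia.
have eS := ordered_draws_fact le_iSm.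
have e0 := ordered_draws_fact le_mi.
have eb := bin_fact hd.
have er : (m - i * D - d = m.+1 - i.+1 * D)%N by rewrite mulSn /D; lia.
rewrite er in eb.
set r := (m.+1 - i.+1 * D)%N in eS eb.
have em : (m.+1 = r + i.+1 * D)%N by rewrite /r subnK.
have p1 : (0 < D`! ^ i.+1 * r`!)%N by rewrite muln_gt0 expn_gt0 !fact_gt0.
apply/eqP; rewrite -(eqn_pmul2r p1) mulnA eS mulnDl; apply/eqP.
have -> : (i.+1 * ('C(m - i * D, d) * ordered_draws D m i) * (D`! ^ i.+1 * r`!)
          = i.+1 * D * m`!)%N.
  by rewrite -e0 -eb expnS {2}/D factS -/D; ring.
have -> : (ordered_draws D m i.+1 * (D`! ^ i.+1 * r`!) = r * m`!)%N.
  case: (leqP (i.+1 * D) m) => [le_m | lt_m].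
    rewrite -(ordered_draws_fact le_m) (_ : r = (m - i.+1 * D).+1) ?factS //.
      by ring.
    by rewrite /r subSn.
  by rewrite ordered_draws_small // (_ : r = 0%N) //; apply/eqP; rewrite subn_eq0.
by rewrite factS {1}em mulnDl.
Qed.

(** The sum over the chains a < l_1 < ... < l_i <= b, peeled off from the
    left. The weight of a factor is indexed by the number of factors to its
    right, so that the tail of a chain carries the same weights as a chain
    of length i - 1. *)
Fixpoint chain_sum (w : nat -> nat -> nat) (b i a : nat) : nat :=
  if i is i'.+1 then
    (\sum_(a.+1 <= l < b.+1) w i' l * chain_sum w b i' l)%N
  else 1%N.

Lemma sum_chains (w : nat -> nat -> nat) (n b i a : nat) : (b <= n)%N ->
  (\sum_(l : {ffun 'I_i -> 'I_n.+1} |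
       [forall j : 'I_i, a < l j <= b] &&
       [forall j : 'I_i, forall k : 'I_i, (j < k) ==> (l j < l k)])
     \prod_(j < i) w (i - j.+1) (l j) = chain_sum w b i a)%N.
Proof.
move=> le_bn; elim: i a => [|i IHi] a /=.
  rewrite (big_pred1 [ffun=> ord0]) ?big_ord0 // => l /=.
  have -> : l == [ffun=> ord0] by apply/eqP/ffunP=> - [].
  by apply/andP; split; apply/forallP => - [].
(* A chain is its first element together with the rest of it. *)
pose glue (p : 'I_n.+1 * {ffun 'I_i -> 'I_n.+1}) : {ffun 'I_i.+1 -> 'I_n.+1} :=
  [ffun j => if unlift ord0 j is Some k then p.2 k else p.1].
pose cut (l : {ffun 'I_i.+1 -> 'I_n.+1}) := (l ord0, [ffun j => l (lift ord0 j)]).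
have glue0 p : glue p ord0 = p.1 by rewrite ffunE unlift_none.
have glueS p j : glue p (lift ord0 j) = p.2 j by rewrite ffunE liftK.
have glueK : cancel glue cut.
  move=> [x l]; rewrite /cut glue0; congr pair.
  by apply/ffunP=> j; rewrite ffunE glueS.
have cutK : cancel cut glue.
  move=> l; apply/ffunP=> j; rewrite ffunE.
  by case: unliftP => [k|] -> //=; rewrite ffunE.
rewrite (reindex glue) /=; last by exists cut => p _; rewrite ?glueK ?cutK.
transitivity (\sum_(x < n.+1 | a < x <= b) w i x * chain_sum w b i x)%N; last first.
  rewrite (big_nat_widen _ _ n.+1) // big_geq_mkord.
  by apply: eq_bigl => x; rewrite ltnS andbC.
under [RHS]eq_bigr do rewrite -IHi big_distrr /=.
rewrite (pair_big_dep (fun x : 'I_n.+1 => a < x <= b)%N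
  (fun (x : 'I_n.+1) (l : {ffun 'I_i -> 'I_n.+1}) =>
    [forall j : 'I_i, x < l j <= b] &&
    [forall j : 'I_i, forall k : 'I_i, (j < k) ==> (l j < l k)])%N
  (fun (x : 'I_n.+1) (l : {ffun 'I_i -> 'I_n.+1}) =>
    w i x * \prod_(j < i) w (i - j.+1) (l j)))%N /=.
apply: eq_big => [[x l]|[x l] _] /=; last first.
  rewrite big_ord_recl glue0 subSS subn0; congr (_ * _)%N.
  by apply: eq_bigr => j _; rewrite glueS.
apply/andP/and3P => [[/forallP bd /forallP inc]|[bx /forallP bd /forallP inc]].
  have bx := bd ord0; rewrite glue0 /= in bx.
  have {}inc j k := implyP (forallP (inc j) k).
  split=> //.
    apply/forallP => j; have := bd (lift ord0 j); have := inc ord0 (lift ord0 j).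
    by rewrite glue0 glueS /= => -> // /andP[_ ->].
  apply/forallP => j; apply/forallP => k; apply/implyP => jk.
  by have := inc (lift ord0 j) (lift ord0 k); rewrite !glueS !lift0 ltnS; apply.
have {}inc j k := implyP (forallP (inc j) k).
split.
  apply/forallP => j; case: (unliftP ord0 j) => [k|] ->; rewrite ?glue0 ?glueS //=.
  by have /andP[xk ->] := bd k; case/andP: bx => ax _; rewrite (ltn_trans ax xk).
apply/forallP => j; apply/forallP => k; apply/implyP.
case: (unliftP ord0 j) => [j'|] ->; case: (unliftP ord0 k) => [k'|] ->;
  rewrite ?glue0 ?glueS ?lift0 //= ?ltnS => jk.
  exact: inc.
by have /andP[] := bd k'.
Qed.

(** Prepending the point a + 1 as a possible minimum increases both sides by
    the same amount, by [ordered_drawsS]. The chain starts beyond the point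
    a, hence the ground set of size n - a; no block has its minimum beyond
    n-d, where d is one less than the block size. *)
Lemma chain_sum_draws (n d i a : nat) : (d < n)%N -> (a <= n - d)%N ->
  (i`! * chain_sum (fun k l => binz (n%:Z - l%:Z - d.+1%:Z * k%:Z)%R d) (n - d) i a
   = ordered_draws d.+1 (n - a) i)%N.
Proof.
move=> lt_dn; set w := fun k l => _; elim: i a => [|i IHi] a le_ab.
  by rewrite /ordered_draws big_ord0.
have step l : (l < n - d)%N ->
    (ordered_draws d.+1 (n - l) i.+1 = ordered_draws d.+1 (n - l.+1) i.+1
      + i.+1`! * (w i l.+1 * chain_sum w (n - d) i l.+1))%N.
  move=> lt_l; rewrite (_ : n - l = (n - l.+1).+1)%N; last by lia.
  rewrite ordered_drawsS; congr addn.
  rewrite factS -mulnA; congr muln; rewrite mulnCA IHi //.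
  (* For blocks of size 1 the weight, which is 0 at negative integers,
     differs from the binomial coefficient with truncated subtraction; in
     that range the other factor vanishes. *)
  have [lt_m|le_m] := ltnP (n - l.+1) (i * d.+1).
    by rewrite ordered_draws_small // !muln0.
  congr muln; rewrite /w.
  rewrite (_ : (_ - _)%R = Posz (n - l.+1 - i * d.+1)) //.
  lia.
have e k : (k = n - d - a)%N -> (i.+1`! * chain_sum w (n - d) i.+1 a
   = ordered_draws d.+1 (n - a) i.+1)%N; last exact: (e _ erefl).
elim: k a le_ab => [|k IHk] a le_ab ek.
  rewrite /= big_geq ?muln0 ?ordered_draws_small //; first by rewrite mulSn; lia.
  lia.
rewrite step; last by lia.
rewrite -IHk; [|lia|lia].
rewrite [LHS]/= big_ltn ?mulnDr 1?addnC //; lia.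
Qed.

Local Open Scope ring_scope.

(** * Alternating sums of binomial coefficients *)

Lemma alternating_binomials m :
  \sum_(k < m.+1) (-1) ^+ k * 'C(m.+1, k)%:Z = (-1) ^+ m :> int.
Proof.
have := exprDn (1 : int) (-1) m.+1; rewrite subrr expr0n /= big_ord_recr /=.
rewrite binn mulr1n subnn expr0 mul1r exprS mulN1r => /esym/eqP.
rewrite subr_eq0 => /eqP <-; apply: eq_bigr => k _.
by rewrite expr1n mul1r -mulr_natr natz.
Qed.

(** For u <= s, since C(m-u, t-u) C(m-t, s-t) = C(m-u, s-u) C(s-u, t-u), the
    sum is C(m-u, s-u) times the expansion of (1 - 1)^(s-u). The lower
    indices m-t and m-s make the terms with t < u vanish, so that the sum
    can start at 0. *)
Lemma bin_inversion (m u s : nat) : (u <= m)%N -> (s <= m)%N ->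
  \sum_(t < s.+1) 'C(m - t, m - s)%:Z * (-1) ^+ (s - t) * 'C(m - u, m - t)%:Z
    = (u == s)%:Z.
Proof.
move=> um sm; rewrite -(big_mkord predT (fun t =>
  'C(m - t, m - s)%:Z * (-1) ^+ (s - t) * 'C(m - u, m - t)%:Z)) /=.
have small t : (t < u)%N -> 'C(m - u, m - t) = 0%N.
  by move=> tu; apply: bin_small; lia.
have [su | us] := ltnP s u.
  rewrite gtn_eqF // big_nat big1 // => t /andP[_ ts].
  by rewrite small ?mulr0 // (leq_trans ts).
rewrite (big_cat_nat (n := u)) //=; last exact: leqW.
rewrite big_nat big1 ?add0r => [|t /andP[_ tu]]; last by rewrite small ?mulr0.
have -> : (u == s) = (s - u == 0)%N by rewrite subn_eq0 eqn_leq us.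
have ba : (s - u <= m - u)%N by rewrite leq_sub2r.
move: (s - u)%N (subnK us) (m - u)%N (subnK um) ba => b <- a <- ba {us um sm small}.
rewrite -{1}[u]add0n big_addn -addSn addnK big_mkord.
transitivity ('C(a, b)%:Z * \sum_(k < b.+1) (-1) ^+ (b - k) * 1 ^+ k *+ 'C(b, k)).
  rewrite big_distrr /=; apply: eq_bigr => k _.
  have kb : (k <= b)%N by rewrite -ltnS.
  rewrite expr1n mulr1 -mulr_natr natz.
  have -> : (a + u - (k + u) = a - k)%N by lia.
  have -> : (a + u - (b + u) = a - b)%N by lia.
  have -> : (b + u - (k + u) = b - k)%N by lia.
  have ka := leq_trans kb ba.
  rewrite mulrAC -PoszM mulrCA [RHS]mulrC -PoszM; congr (Posz _ * _).
  rewrite bin_sub //.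
  apply/eqP; rewrite -(eqn_pmul2r (fact_gt0 k)) -(eqn_pmul2r (fact_gt0 (b - k))).
  rewrite -(eqn_pmul2r (fact_gt0 (a - b))); apply/eqP.
  have hb : (a - b <= a - k)%N by lia.
  have := bin_fact hb; have -> : (a - k - (a - b) = b - k)%N by lia.
  have := bin_fact ka; rewrite -(bin_fact ba) -(bin_fact kb) => e1 e2.
  by rewrite -e2 in e1; move: e1; nia.
by rewrite -exprDn addNr expr0n; case: eqP => [->|]; rewrite ?bin0 ?mulr0.
Qed.

(** * Supports and frames *)

Section Supports.
Variables (F : finFieldType) (n : nat).
Implicit Types (v : 'rV[F]_n) (s b : seq 'rV[F]_n) (U : {vspace 'rV[F]_n}).

Definition supp v : {set 'I_n} := [set k | v 0 k != 0].
Definition suppv U : {set 'I_n} := \bigcup_(v : 'rV[F]_n | v \in U) supp v.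

Lemma supp_eq0 v : (supp v == set0) = (v == 0).
Proof.
apply/eqP/eqP => [v0 | ->]; last by apply/setP=> k; rewrite !inE mxE eqxx.
apply/rowP=> k; rewrite mxE; apply/eqP.
by have := in_set0 k; rewrite -v0 inE => /negbFE.
Qed.

Lemma suppZ a v : a != 0 -> supp (a *: v) = supp v.
Proof. by move=> a0; apply/setP=> k; rewrite !inE mxE mulf_eq0 negb_or a0. Qed.

Lemma supp_subv v U : v \in U -> supp v \subset suppv U.
Proof. exact: (bigcup_sup v). Qed.

Lemma suppvP U (A : {set 'I_n}) :
  reflect (forall v, v \in U -> supp v \subset A) (suppv U \subset A).
Proof. exact: bigcupsP. Qed.

Lemma suppvS U V : (U <= V)%VS -> suppv U \subset suppv V.
Proof. by move=> /subvP UV; apply/suppvP=> v /UV /supp_subv. Qed.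

Lemma suppv_nil : suppv <<[::]>> = set0.
Proof.
apply/eqP; rewrite -subset0; apply/suppvP=> v.
by rewrite span_nil memv0 -supp_eq0 => /eqP ->.
Qed.

Lemma suppv_cons v s : suppv <<v :: s>> = supp v :|: suppv <<s>>.
Proof.
rewrite span_cons; apply/eqP; rewrite eqEsubset subUset supp_subv; last first.
  by rewrite (subvP (addvSl _ _)) ?memv_line.
rewrite suppvS ?addvSr // !andbT.
apply/suppvP => _ /memv_addP[_ /vlineP[a ->] [w ws ->]].
have /subsetP wS := supp_subv ws.
apply/subsetP => k; rewrite inE; apply: contraR.
rewrite !inE negb_or negbK => /andP[/eqP vk kw].
rewrite !mxE vk mulr0 add0r; apply: contraR kw => wk; apply: wS.
by rewrite inE.
Qed.

Lemma card_suppv_span d s : all (fun v => hweight v <= d)%N s ->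
  (#|suppv <<s>>| <= size s * d)%N.
Proof.
elim: s => [|v s IHs] /=; first by rewrite suppv_nil cards0.
move=> /andP[vd sd]; rewrite suppv_cons mulSn.
by rewrite (leq_trans (leq_card_setU _ _)) // leq_add ?IHs.
Qed.

(** A frame consists of vectors of weight exactly d with pairwise disjoint
    supports. Disjointness from the span of the tail rather than from each
    of its vectors makes every induction on the frame immediate;
    [disjoint_suppv] recovers the pairwise form. *)
Fixpoint frame d s : bool :=
  if s is v :: s' then
    [&& hweight v == d, [disjoint supp v & suppv <<s'>>] & frame d s']
  else true.

(** Equality in the union bound [card_suppv_span] forces every weight to be
    d and the supports to be disjoint. *)
Lemma frame_card d s : all (fun v => hweight v <= d)%N s ->
  frame d s = (#|suppv <<s>>| == size s * d)%N.
Proof.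
elim: s => [|v s IHs] /=; first by rewrite suppv_nil cards0.
move=> /andP[vd sd]; rewrite suppv_cons mulSn IHs // -leq_card_setU.
have [le1 _] := leq_card_setU (supp v) (suppv <<s>>).
have := card_suppv_span sd; have : #|supp v| = hweight v by [].
move: vd le1; move: #|supp v| #|suppv _| #|_ :|: _| => x y z.
move=> h1 h2 h3 h4; apply/and3P/eqP => [[/eqP ? /eqP ? /eqP ?]|?]; first by lia.
by split; apply/eqP; lia.
Qed.

Lemma frame_hweight d s : frame d s -> {in s, forall v, hweight v = d}.
Proof.
elim: s => //= u s IHs /and3P[/eqP ud _ sd] v.
by rewrite inE => /predU1P[-> //|]; apply: IHs.
Qed.

Lemma card_suppv_frame d s : frame d s -> #|suppv <<s>>| = (size s * d)%N.
Proof.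
move=> fs; apply/eqP; rewrite -frame_card //.
by apply/allP => v vs; rewrite (frame_hweight fs).
Qed.

Lemma hweight0 v : (hweight v == 0)%N = (v == 0).
Proof. by rewrite cards_eq0 supp_eq0. Qed.

Lemma frame_free d s : (0 < d)%N -> frame d s -> free s.
Proof.
move=> d0; elim: s => [|v s IHs] /=; first by rewrite nil_free.
move=> /and3P[/eqP vd dis /IHs fs]; rewrite free_cons fs andbT.
apply: contraL dis => /supp_subv /setIidPl vs; rewrite -setI_eq0 vs supp_eq0.
by rewrite -hweight0 vd -lt0n.
Qed.

Lemma frame_dim d s : (0 < d)%N -> frame d s -> \dim <<s>> = size s.
Proof. by move=> d0 /(frame_free d0) /eqP. Qed.

(** For d > 0, a combination with two nonzero coefficients has weight at
    least 2d > d. In the induction, if the coefficient of the head b is not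
    0, then the support of v contains that of b, hence equals it by
    cardinality, and the component in the span of the tail is 0. *)
Lemma frame_low d s v : frame d s -> v \in <<s>>%VS -> v != 0 ->
    (hweight v <= d)%N ->
  exists2 b, b \in s & exists2 a, a != 0 & v = a *: b.
Proof.
elim: s v => [|b s IHs] v /=; first by rewrite span_nil memv0 => _ ->.
move=> /and3P[/eqP bd dis fs]; rewrite span_cons.
move=> /memv_addP[_ /vlineP[a ->] [w ws defv]] v0 vd.
have [a0 | a0] := eqVneq a 0.
  have [|//|//|c cs vc] := IHs v fs; first by rewrite defv a0 scale0r add0r.
  by exists c; rewrite // inE cs orbT.
exists b; rewrite ?mem_head //; exists a => //.
have wb k : k \in supp b -> w 0 k = 0.
  move=> kb; apply/eqP; apply: contraTT kb => wk.
  by rewrite (disjointFl dis) // (subsetP (supp_subv ws)) ?inE.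
have eq_bv : supp b = supp v.
  apply/eqP; rewrite eqEcard -/(hweight v) -/(hweight b) bd vd andbT.
  apply/subsetP=> k kb; have := kb; rewrite !inE defv !mxE wb // addr0 => bk.
  by rewrite mulf_neq0.
rewrite defv; suff -> : w = 0 by rewrite addr0.
apply/rowP=> k; rewrite mxE; have [/wb // | kb] := boolP (k \in supp b).
have := kb; rewrite eq_bv; move: kb; rewrite !inE !negbK defv !mxE.
by move=> /eqP ->; rewrite mulr0 add0r => /eqP.
Qed.

Lemma frame_disjoint d s : frame d s ->
  {in s &, forall u v, u != v -> [disjoint supp u & supp v]}.
Proof.
elim: s => //= w s IHs /and3P[_ dis fs] u v.
have disw x : x \in s -> [disjoint supp w & supp x].
  by move=> xs; apply: disjointWr dis; rewrite supp_subv ?memv_span.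
rewrite !inE => /predU1P[-> | us] /predU1P[-> | vs]; first by rewrite eqxx.
- by rewrite disw.
- by rewrite disjoint_sym disw.
- exact: IHs.
Qed.

Lemma frame_supp_inj d s : (0 < d)%N -> frame d s -> {in s &, injective supp}.
Proof.
move=> d0 fs u v us vs eq_uv; apply: contraTeq d0 => /(frame_disjoint fs us vs).
rewrite -eq_uv -setI_eq0 setIid supp_eq0 -hweight0 (frame_hweight fs us).
by rewrite lt0n negbK.
Qed.

Lemma frame_supp_low d b v : frame d b -> v \in <<b>>%VS -> v != 0 ->
  (hweight v <= d)%N -> supp v \in map supp b.
Proof.
by move=> fb vU v0 /(frame_low fb vU v0)[c cb [a a0 ->]]; rewrite suppZ ?map_f.
Qed.

Lemma disjoint_suppv (A : {set 'I_n}) s :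
  [disjoint A & suppv <<s>>] = all (fun v => [disjoint A & supp v]) s.
Proof.
elim: s => [|v s IHs] /=; first by rewrite suppv_nil -setI_eq0 setI0 eqxx.
by rewrite suppv_cons -IHs -!setI_eq0 setIUr setU_eq0.
Qed.

Lemma card_supp_in_frame d b (B : {set 'I_n}) : (0 < d)%N -> frame d b ->
  B \in map supp b ->
  #|[set v in <<b>>%VS | supp v == B]| = (#|F| - 1)%N.
Proof.
move=> d0 fb Bb; have [c cb eB] := mapP Bb.
have c0 : c != 0 by rewrite -hweight0 (frame_hweight fb) // -lt0n.
have injc : injective (fun a : F => a *: c).
  move=> a a' /eqP; rewrite -subr_eq0 -scalerBl scaler_eq0 (negPf c0) orbF.
  by rewrite subr_eq0 => /eqP.
rewrite subn1 -(cardC1 0) -(card_imset _ injc); apply: eq_card => v; rewrite !inE.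
apply/andP/imsetP => [[vU /eqP sv]|[a a0 ->]].
  have vd : hweight v = d by rewrite -(frame_hweight fb cb) -[LHS]/#|supp v| sv eB.
  have v0 : v != 0 by rewrite -hweight0 vd -lt0n.
  have [|c' cb' [a a0 defv]] := frame_low fb vU v0; first by rewrite vd.
  exists a; first by rewrite !inE.
  rewrite {}defv suppZ // in sv *; congr (_ *: _).
  by apply: (frame_supp_inj d0 fb) => //; rewrite sv eB.
by rewrite inE in a0; rewrite memvZ ?memv_span // suppZ // eB.
Qed.

Lemma card_supp_eq (B : {set 'I_n}) :
  #|[set v : 'rV[F]_n | supp v == B]| = ((#|F| - 1) ^ #|B|)%N.
Proof.
rewrite subn1 -(cardC1 0) -(card_pffun_on (0 : F)).
have inj_row : injective (fun f : {ffun 'I_n -> F} => \row_k f k).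
  by move=> f g /rowP fg; apply/ffunP=> k; have := fg k; rewrite !mxE.
rewrite -(card_imset _ inj_row); apply: eq_card => v; rewrite inE.
apply/eqP/imsetP => [sv | [f]].
  exists [ffun k => v 0 k]; last by apply/rowP=> k; rewrite !mxE ffunE.
  apply/pfamilyP; split=> [|k kB].
    by apply/subsetP=> k; rewrite !inE ffunE -sv inE.
  by rewrite !inE ffunE; rewrite -sv inE in kB.
move=> /pfamilyP[/subsetP fB Bf] ->; apply/setP=> k; rewrite inE mxE.
apply/idP/idP => [fk | kB]; first by apply: fB; rewrite inE.
by have := Bf k kB; rewrite inE.
Qed.

(** The support of the new vector is a d-subset of the coordinates that the
    frame leaves free, and its d nonzero entries are arbitrary. *)
Lemma card_frame_ext d s : frame d s ->
  #|[set v | frame d (v :: s)]| = ('C(n - size s * d, d) * (#|F| - 1) ^ d)%N.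
Proof.
move=> fs; set S := suppv <<s>>.
have cS : #|~: S| = (n - size s * d)%N.
  by rewrite cardsCs setCK card_ord (card_suppv_frame fs).
rewrite -cS -cards_draws -sum_nat_const -sum1_card.
rewrite (partition_big supp
  (mem [set B : {set 'I_n} | B \subset ~: S & #|B| == d])) /=.
  apply: eq_bigr => B; rewrite inE => /andP[BS /eqP Bd].
  rewrite -[in RHS]Bd -card_supp_eq -sum1_card; apply: eq_bigl => v.
  rewrite !inE /= fs andbT; case: (supp v =P B) => [sv|]; rewrite ?andbF // andbT.
  by rewrite -[hweight v]/#|supp v| sv Bd eqxx disjoints_subset.
by move=> v; rewrite !inE /= disjoints_subset fs andbT andbC.
Qed.

(** By [frame_low] the frames inside the span of b are made of multiples of
    elements of b. So a vector extends s exactly when its support is the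
    support of an element of b that is not yet the support of an element of
    s, and then it is determined up to a nonzero scalar. *)
Lemma card_frame_ext_in d b s : (0 < d)%N -> frame d b -> frame d s ->
    {subset s <= <<b>>%VS} ->
  #|[set v in <<b>>%VS | frame d (v :: s)]| = ((size b - size s) * (#|F| - 1))%N.
Proof.
move=> d0 fb fs sb.
pose SB := [set B in map supp b]; pose SS := [set B in map supp s].
have nz v : hweight v = d -> v != 0 by rewrite -hweight0 => ->; rewrite -lt0n.
have low v : v \in <<b>>%VS -> hweight v = d -> supp v \in map supp b.
  by move=> vU vd; apply: (frame_supp_low fb) => //; rewrite ?nz ?vd.
have card_map t : frame d t -> #|[set B in map supp t]| = size t.
  move=> ft; rewrite cardsE (card_uniqP _) ?size_map //.
  by rewrite (map_inj_in_uniq (frame_supp_inj d0 ft)) (free_uniq (frame_free d0 ft)).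
have sSB : SS \subset SB.
  apply/subsetP => B; rewrite !inE => /mapP[v vs ->]; apply: low (sb _ vs) _.
  exact: frame_hweight vs.
have -> : (size b - size s = #|SB :\: SS|)%N.
  by rewrite cardsD (setIidPr sSB) !card_map.
rewrite -sum_nat_const -sum1_card (partition_big supp (mem (SB :\: SS))) /=.
  apply: eq_bigr => B; rewrite !inE => /andP[Bs Bb].
  rewrite -(card_supp_in_frame d0 fb Bb) -sum1_card; apply: eq_bigl => v.
  rewrite !inE /= fs andbT; case: (supp v =P B) => [sv|]; rewrite ?andbF // andbT.
  case vU: (v \in _) => //=; have [c cb eB] := mapP Bb.
  have -> : hweight v = d by rewrite -(frame_hweight fb cb) -[LHS]/#|supp v| sv eB.
  rewrite eqxx sv /=.
  rewrite disjoint_suppv; apply/allP => u us.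
  have /mapP[w wb eq_uw] := low u (sb u us) (frame_hweight fs us).
  rewrite eB eq_uw; apply: (frame_disjoint fb) => //.
  by apply: contraNneq Bs => cw; rewrite eB cw -eq_uw map_f.
move=> v; rewrite !inE /= => /and4P[vU /eqP vd dis _].
rewrite low // andbT; apply/mapP => -[u us eq_uv].
have /negP := nz v vd; rewrite -supp_eq0 -subset0; apply.
rewrite -(setIid (supp v)) {2}eq_uv; move: dis; rewrite -setI_eq0 => /eqP <-.
by rewrite setIS // supp_subv // memv_span.
Qed.
End Supports.

(** * Subspaces spanned by a frame *)

(** The multiplication principle: if a valid sequence of length j always has
    a j valid extensions, there are a 0 * ... * a (k - 1) valid sequences of
    length k. It is applied to all frames, and to the frames inside a given
    subspace. *)
Lemma card_tuples (T : finType) (P : pred (seq T)) (a : nat -> nat) k :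
    P [::] -> (forall x s, P (x :: s) -> P s) ->
    (forall s, P s -> #|[set x | P (x :: s)]| = a (size s)) ->
  #|[set s : k.-tuple T | P s]| = (\prod_(j < k) a j)%N.
Proof.
move=> P0 Ptail Pa; elim: k => [|k IHk].
  rewrite big_ord0; apply: (@eq_card1 _ [tuple]) => s.
  by rewrite inE tuple0 P0 inE eqxx.
rewrite big_ord_recr /= -IHk -sum_nat_const -sum1_card.
pose glue (p : T * k.-tuple T) := [tuple of p.1 :: p.2].
rewrite (reindex glue) /=; last first.
  exists (fun s : k.+1.-tuple T => (thead s, [tuple of behead s])) => [[x s] _|s _].
    by congr pair; apply: val_inj.
  by rewrite /glue -tuple_eta.
under [RHS]eq_bigr => s Ps.
  rewrite inE in Ps; rewrite -[k in a k](size_tuple s) -Pa // -sum1_card.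
  under eq_bigl do rewrite inE.
  over.
rewrite (exchange_big_dep predT) //= pair_big_dep /=.
by apply: eq_bigl => -[x s]; rewrite !inE /= andb_idl // => /Ptail.
Qed.

Section Framed.
Variables (F : finFieldType) (n d : nat).
Hypothesis d_gt0 : (0 < d)%N.
Implicit Types (s : seq 'rV[F]_n) (U V W : {vspace 'rV[F]_n}).

Definition framed U : bool :=
  [exists s : (\dim U).-tuple 'rV[F]_n, frame d s && (<<s>>%VS == U)].

Lemma framedP U :
  reflect (exists2 s, frame d s & <<s>>%VS = U) (framed U).
Proof.
apply: (iffP existsP) => [[s /andP[fs /eqP sU]] | [s fs sU]]; first by exists s.
have sz : size s == \dim U by rewrite -sU (frame_dim d_gt0 fs).
by exists (Tuple sz); rewrite /= fs sU eqxx.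
Qed.

Definition frames_in k U : {set k.-tuple 'rV[F]_n} :=
  [set s : k.-tuple 'rV[F]_n | frame d s && all (mem U) s].

Lemma frame_span_eq U s : frame d s -> all (mem U) s -> size s = \dim U ->
  <<s>>%VS = U.
Proof.
move=> fs /allP sU szs; apply/eqP; rewrite eqEdim (frame_dim d_gt0 fs) szs leqnn.
by rewrite andbT; apply/span_subvP.
Qed.

Lemma card_frames_framed k U : framed U ->
  #|frames_in k U| = ((\dim U) ^_ k * (#|F| - 1) ^ k)%N.
Proof.
move=> /framedP[b fb <-]; rewrite (frame_dim d_gt0 fb) ffact_prod.
have -> : ((#|F| - 1) ^ k = \prod_(j < k) (#|F| - 1))%N.
  by rewrite prod_nat_const card_ord.
rewrite -big_split /=.
apply: (@card_tuples _ (fun s => frame d s && all (mem <<b>>%VS) s)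
  (fun j => (size b - j) * (#|F| - 1))%N k) => // [x s|s /andP[fs /allP sb]].
  by rewrite /= => /andP[/and3P[_ _ ->] /andP[_ ->]].
rewrite -(card_frame_ext_in d_gt0 fb fs sb); apply: eq_card => v.
have sb' : all (mem <<b>>%VS) s by apply/allP.
by rewrite !inE /= sb' andbT andbC.
Qed.

Lemma card_frames_full k :
  #|frames_in k fullv| = (ordered_draws d n k * (#|F| - 1) ^ (k * d))%N.
Proof.
have -> : ((#|F| - 1) ^ (k * d) = \prod_(j < k) (#|F| - 1) ^ d)%N.
  by rewrite prod_nat_const card_ord mulnC expnM.
rewrite /ordered_draws -big_split /=.
have full s : all (mem (fullv : {vspace 'rV[F]_n})) s.
  by apply/allP => v _; apply: memvf.
rewrite -(card_tuples (P := @frame F n d)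
  (a := fun j => ('C(n - j * d, d) * (#|F| - 1) ^ d)%N)) //.
- by apply: eq_card => s; rewrite !inE full andbT.
- by move=> x s /and3P[].
exact: card_frame_ext.
Qed.

Definition framed_subspaces k U : {set {vspace 'rV[F]_n}} :=
  [set V : {vspace 'rV[F]_n} | [&& framed V, (V <= U)%VS & \dim V == k]].

(** The frames are sorted by their span, and a span of dimension k has
    k!(q-1)^k of them. Taking for U the whole space counts all spans of
    frames; taking for U the span of a frame counts the framed subspaces of
    U. *)
Lemma card_frames_subspaces k U :
  #|frames_in k U| = (#|framed_subspaces k U| * (k`! * (#|F| - 1) ^ k))%N.
Proof.
rewrite -sum_nat_const -sum1_card.
rewrite (partition_big (fun s : k.-tuple _ => <<s>>%VS)
  (mem (framed_subspaces k U))) /=.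
  apply: eq_bigr => V; rewrite inE => /and3P[fV VU /eqP dimV].
  have := card_frames_framed k fV; rewrite dimV ffactnn => <-.
  rewrite -sum1_card; apply: eq_bigl => s; rewrite !inE /=.
  apply/andP/andP => [[/andP[fs sU] /eqP <-]|[fs sV]].
    by rewrite fs; split=> //; apply/allP => v; apply: memv_span.
  rewrite fs (frame_span_eq fs sV) ?size_tuple ?dimV //.
  by split=> //; apply: sub_all sV => v; apply: (subvP VU).
move=> s; rewrite !inE => /andP[fs /allP sU].
rewrite (frame_dim d_gt0 fs) size_tuple eqxx andbT; apply/andP; split.
  by apply/framedP; exists s.
exact/span_subvP.
Qed.

Hypothesis q_gt1 : (1 < #|F|)%N.

Lemma card_framed_subspaces k U : framed U ->
  #|framed_subspaces k U| = 'C(\dim U, k).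
Proof.
move=> fU; apply/eqP; have := card_frames_framed k fU.
rewrite card_frames_subspaces -bin_ffact mulnA => /eqP.
by rewrite eqn_pmul2r ?eqn_pmul2r ?fact_gt0 // expn_gt0 subn_gt0 q_gt1.
Qed.

Lemma card_framed_full k :
  (k`! * #|framed_subspaces k fullv|
     = ordered_draws d n k * (#|F| - 1) ^ (k * (d - 1)))%N.
Proof.
have q0 : (0 < (#|F| - 1) ^ k)%N by rewrite expn_gt0 subn_gt0 q_gt1.
apply/eqP; rewrite -(eqn_pmul2r q0) -[X in _ == X]mulnA -expnD mulnBr muln1.
rewrite subnK ?leq_pmulr // -card_frames_full card_frames_subspaces.
by rewrite [X in _ == X]mulnCA mulnA.
Qed.

End Framed.

Section Dowling.
Variables (F : finFieldType) (n d : nat).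
Implicit Types (s : seq 'rV[F]_n) (U V : dowling F n d).

Lemma lowP (U : {vspace 'rV[F]_n}) :
  reflect (exists2 s, basis_of U s & all (fun v => hweight v <= d)%N s)
          ((U == 0%VS) || low_weight_basis d U).
Proof.
apply: (iffP orP) => [[/eqP-> | /existsP[s /andP[Us lows]]] | [s Us lows]].
- by exists [::] => //; rewrite basisEdim span_nil subvv dimv0.
- by exists s.
have sz : size s == \dim U by rewrite (size_basis (X := in_tuple s) Us).
by right; apply/existsP; exists (Tuple sz); rewrite /= Us.
Qed.

Lemma dowlingP U : exists2 s, basis_of U s & all (fun v => hweight v <= d)%N s.
Proof. by case: U => U lowU; apply/lowP. Qed.

Lemma card_suppv_dowling U : (#|suppv U| <= \dim U * d)%N.
Proof.
have [s Us lows] := dowlingP U.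
by rewrite -(span_basis Us) (eqP (basis_free Us)) card_suppv_span.
Qed.

Hypothesis d_gt0 : (0 < d)%N.

(** If the support is as large as the rank allows, then every low-weight
    basis is a frame, by [frame_card]. *)
Lemma framed_card U : framed d U = (#|suppv U| == \dim U * d)%N.
Proof.
apply/(framedP d_gt0)/idP => [[s fs <-] | ].
  by rewrite (card_suppv_frame fs) (frame_dim d_gt0 fs).
have [s Us lows] := dowlingP U; rewrite -(span_basis Us) (eqP (basis_free Us)).
by rewrite -frame_card // => fs; exists s.
Qed.

Lemma framed_low (U : {vspace 'rV[F]_n}) : framed d U ->
  (U == 0%VS) || low_weight_basis d U.
Proof.
move=> /(framedP d_gt0)[s fs sU]; apply/lowP; exists s.
  by rewrite basisEfree (frame_free d_gt0 fs) sU subvv -sU (frame_dim d_gt0 fs) /=.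
by apply/allP => v vs; rewrite (frame_hweight fs vs).
Qed.

(** Each vector of a low-weight basis of U is a multiple of an element of a
    frame b of W. Different basis vectors use different elements of b, since
    they are independent; so the basis is itself a frame. *)
Lemma framed_sub U (W : {vspace 'rV[F]_n}) : framed d W -> (U <= W)%VS -> framed d U.
Proof.
move=> /(framedP d_gt0)[b fb <-] Ub; have [s Us lows] := dowlingP U.
apply/(framedP d_gt0); exists s; last exact: span_basis.
have low v : v \in s -> [/\ v != 0, v \in <<b>>%VS & (hweight v <= d)%N].
  move=> vs; split; last exact: (allP lows v vs).
    exact: free_not0 (basis_free Us) vs.
  exact: (subvP Ub) (basis_mem Us vs).
elim: s {Us} (basis_free Us) low {lows} => //= v s IHs.
rewrite free_cons => /andP[vns frs] low.
have fs : frame d s by apply: IHs => // u us; apply: low; rewrite inE us orbT.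
have [v0 vb vd] := low v (mem_head _ _).
have [c cb [a a0 defv]] := frame_low fb vb v0 vd.
rewrite fs andbT; apply/andP; split.
  by rewrite -[hweight v]/#|supp v| defv suppZ // [#|_|](frame_hweight fb cb).
rewrite disjoint_suppv; apply/allP => u us.
have [|u0 ub ud] := low u; first by rewrite inE us orbT.
have [c' cb' [a' a'0 defu]] := frame_low fb ub u0 ud.
rewrite defv defu !suppZ //; apply: (frame_disjoint fb) => //.
apply: contraNneq vns => cc'; rewrite defv cc'.
have -> : c' = a'^-1 *: u by rewrite defu scalerA mulVf // scale1r.
by rewrite !memvZ // memv_span.
Qed.

Hypothesis q_gt1 : (1 < #|F|)%N.

Lemma card_framed_dowling k (W : {vspace 'rV[F]_n}) :
  #|[set V : dowling F n d | [&& framed d V, (V <= W)%VS & \dim V == k]]|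
  = #|framed_subspaces d k W|.
Proof.
rewrite -(card_imset _ val_inj); apply: eq_card => V; rewrite inE.
apply/imsetP/idP => [[V']|VW]; first by rewrite inE => VW ->.
have [fV _ _] := and3P VW.
by exists (Dowling (framed_low fV)); rewrite ?inE.
Qed.

Lemma dowling0_le U : (dowling0 F n d <= U)%O.
Proof. by rewrite -[(_ <= _)%O]/(0 <= dowling_val U)%VS sub0v. Qed.

(** Below U there are C(dim U, k) elements of rank k, as in a Boolean
    lattice, and all of them are framed. So the recursion for mu reduces to
    the vanishing of the alternating sum of binomial coefficients. *)
Lemma mobius_framed U : framed d U -> mobius (dowling0 F n d) U = (-1) ^+ \dim U.
Proof.
have [m] := ubnP (\dim U); elim: m U => // m IHm U; rewrite ltnS => leUm fU.
have := dowling0_le U; rewrite le_eqVlt => /predU1P[<- | lt0U].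
  by rewrite mobius_xx dimv0.
rewrite mobius_lt //; case dimU: (\dim U) => [|k].
  case/negP: (negbT (lt_eqF lt0U)); apply/eqP/val_inj/esym/eqP.
  by rewrite -dimv_eq0 dimU.
rewrite exprS mulN1r -alternating_binomials; congr (- _).
have ltU V : (V < U)%O = (V <= U)%VS && (\dim V < k.+1)%N.
  rewrite lt_neqAle -dimU; apply/andP/andP => -[].
    move=> neVU VU; split=> //; rewrite ltn_neqAle dimvS // andbT.
    apply: contra neVU => /eqP eqd; apply/eqP/val_inj/eqP.
    by rewrite eqEdim eqd leqnn andbT.
  by move=> VU ltd; split=> //; apply: contraTneq ltd => ->; rewrite ltnn.
rewrite (eq_bigl (fun V => (V <= U)%VS && (\dim V < k.+1)%N)); last first.
  by move=> V; rewrite dowling0_le ltU.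
rewrite (partition_big
  (fun V : dowling F n d => inord (\dim V) : 'I_k.+1) predT) //=.
apply: eq_bigr => j _; rewrite -[X in 'C(X, _)]dimU.
rewrite -(card_framed_subspaces d_gt0 q_gt1 j fU).
rewrite -card_framed_dowling -natz mulr_natr -sumr_const.
apply: eq_big => V.
  rewrite inE -andbA; case VU: (V <= U)%VS; rewrite ?andbF //= (framed_sub fU VU) /=.
  apply/andP/eqP => [[ltd /eqP <-]|->]; first by rewrite inordK.
  by split=> //; apply/eqP; rewrite inord_val.
move=> /andP[/andP[VU ltd] /eqP <-]; rewrite inordK // IHm ?(framed_sub fU VU) //.
by rewrite (leq_trans ltd) // -dimU.
Qed.

End Dowling.

(** * Whitney numbers sorted by support size *)

Lemma sum_injective_image (R : nmodType) (I J : finType) (f : I -> J) (P : pred J)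
    (G : J -> R) : injective f -> (forall j, P j -> exists i, j = f i) ->
  \sum_(j | P j) G j = \sum_(i | P (f i)) G (f i).
Proof.
move=> injf imf; rewrite -(big_imset (h := f) G) /=; last by move=> ? ? _ _ /injf.
apply: eq_bigl => j; apply/idP/imsetP => [Pj|[i Pfi ->] //].
by have [i ji] := imf j Pj; exists i; rewrite // unfold_in -ji.
Qed.

(** The recursion for mu (x, y) only visits elements below y, so an
    embedding whose image is closed downwards preserves mu. *)
Lemma mobius_embed (disp1 disp2 : Order.disp_t) (T1 : finPOrderType disp1)
    (T2 : finPOrderType disp2) (f : T1 -> T2) :
    {mono f : x y / (x <= y)%O} ->
    (forall x z, (z <= f x)%O -> exists y, z = f y) ->
  forall x y, mobius (f x) (f y) = mobius x y.
Proof.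
move=> fle fdown x y; have injf := inc_inj fle; have flt := leW_mono fle.
have [m] := ubnP #|[pred z | (z < y)%O]|.
elim: m y => // m IHm y; rewrite ltnS => ltm.
have [->|ne_xy] := eqVneq x y; first by rewrite !mobius_xx.
have [le_xy|nle] := boolP (x <= y)%O; last by rewrite !mobius_nle ?fle.
have lt_xy : (x < y)%O by rewrite lt_neqAle ne_xy.
rewrite !mobius_lt ?flt //; congr (- _).
rewrite (sum_injective_image _ injf) => [|z /andP[_ /ltW]]; last exact: fdown.
apply: eq_big => z; rewrite ?fle ?flt // => /andP[_ lt_zy].
apply: IHm; apply: leq_trans ltm; apply/proper_card/properP; split.
  by apply/subsetP=> u; rewrite !inE => /lt_trans; apply.
by exists z; rewrite !inE ?ltxx.
Qed.

Section Extension.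
Variables (F : finFieldType) (n d : nat) (S : {set 'I_n}).

(** Extension by 0 from the coordinates in S, enumerated by [enum_val], to
    all coordinates. *)
Definition extend : 'Hom('rV[F]_#|S|, 'rV[F]_n) :=
  linfun (mulmxr (\matrix_(k < #|S|, j < n) (enum_val k == j)%:R)).

Lemma extend_val x k : extend x 0 (enum_val k) = x 0 k.
Proof.
rewrite lfunE mxE (bigD1 k) //= mxE eqxx mulr1 big1 ?addr0 // => l lk.
by rewrite mxE (inj_eq enum_val_inj) (negPf lk) mulr0.
Qed.

Lemma extend_out x j : j \notin S -> extend x 0 j = 0.
Proof.
move=> jS; rewrite lfunE mxE big1 // => l _; rewrite mxE.
by case: eqP jS => [<-|]; rewrite ?enum_valP ?mulr0.
Qed.

Lemma supp_extend x : supp (extend x) = enum_val @: supp x.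
Proof.
apply/setP=> j; apply/idP/imsetP => [|[k kx ->]]; last first.
  by rewrite inE extend_val; rewrite inE in kx.
rewrite inE; have [jS | /extend_out ->] := boolP (j \in S); last by rewrite eqxx.
rewrite -(enum_rankK_in jS jS) extend_val => xj.
by exists (enum_rank_in jS j); rewrite ?inE.
Qed.

Lemma hweight_extend x : hweight (extend x) = hweight x.
Proof.
by rewrite -[LHS]/#|supp _| supp_extend card_imset //; apply: enum_val_inj.
Qed.

Lemma extend_inj : injective extend.
Proof. by move=> x y exy; apply/rowP=> k; rewrite -!extend_val exy. Qed.

Lemma ker_extend : lker extend == 0%VS.
Proof. exact/lker0P/extend_inj. Qed.

Lemma extend_surj v : supp v \subset S -> exists x, v = extend x.
Proof.
move=> /subsetP vS; exists (\row_k v 0 (enum_val k)); apply/rowP=> j.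
have [jS | jS] := boolP (j \in S).
  by rewrite -(enum_rankK_in jS jS) extend_val mxE.
rewrite extend_out //; apply/eqP; apply: contraNT jS => vj.
by apply: vS; rewrite inE.
Qed.

Lemma suppv_extend (V : {vspace 'rV[F]_#|S|}) : suppv (extend @: V) \subset S.
Proof.
apply/suppvP => _ /memv_imgP[x _ ->]; rewrite supp_extend.
by apply/subsetP=> _ /imsetP[k _ ->]; apply: enum_valP.
Qed.

Lemma extend_low (V : dowling F #|S| d) :
  (extend @: V == 0)%VS || low_weight_basis d (extend @: V)%VS.
Proof.
have [s Vs lows] := dowlingP V; apply/lowP; exists (map extend s).
  by apply: limg_basis_of Vs; rewrite (eqP ker_extend) capv0.
by rewrite all_map; apply: sub_all lows => x /=; rewrite hweight_extend.
Qed.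

Definition extend_dowling V : dowling F n d := Dowling (extend_low V).

Lemma limg_extend_sub (U V : {vspace 'rV[F]_#|S|}) :
  (extend @: U <= extend @: V)%VS = (U <= V)%VS.
Proof.
apply/idP/idP => [/subvP UV | ]; last exact: limgS.
apply/subvP => u uU.
by have /memv_imgP[v vV /extend_inj ->] := UV _ (memv_img extend uU).
Qed.

Lemma dim_extend (U : {vspace 'rV[F]_#|S|}) : \dim (extend @: U)%VS = \dim U.
Proof. by rewrite limg_dim_eq // (eqP ker_extend) capv0. Qed.

Lemma extend_dowling_le : {mono extend_dowling : U V / (U <= V)%O}.
Proof. exact: limg_extend_sub. Qed.

Lemma extend_dowling0 : extend_dowling (dowling0 F _ d) = dowling0 F n d.
Proof. by apply: val_inj; rewrite /= limg0. Qed.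

(** Restriction to S maps a low-weight basis of U to a low-weight basis of
    the preimage of U, because no vector of U has nonzero coordinates
    outside S. *)
Lemma extend_dowling_surj (U : dowling F n d) :
  suppv U \subset S -> exists V, U = extend_dowling V.
Proof.
move=> /suppvP US; have [s Us lows] := dowlingP U.
pose restrict (v : 'rV[F]_n) : 'rV[F]_#|S| := \row_k v 0 (enum_val k).
have resK : {in s, forall v, extend (restrict v) = v}.
  move=> v vs; have [|x ->] := @extend_surj v; first exact: US (basis_mem Us vs).
  by congr (extend _); apply/rowP=> k; rewrite mxE extend_val.
have exs : map extend (map restrict s) = s.
  by rewrite -map_comp map_id_in.
have imU : (extend @: <<map restrict s>>)%VS = U.
  by rewrite limg_span exs (span_basis Us).
have low : (<<map restrict s>> == 0)%VS || low_weight_basis d <<map restrict s>>%VS.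
  apply/lowP; exists (map restrict s).
    rewrite basisEdim subvv size_map -dim_extend imU -(span_basis Us).
    by rewrite (eqP (basis_free Us)) /=.
  apply/allP => _ /mapP[v vs ->]; rewrite -hweight_extend resK //.
  exact: (allP lows).
by exists (Dowling low); apply: val_inj; rewrite /= imU.
Qed.

Lemma mobius_extend V :
  mobius (dowling0 F n d) (extend_dowling V) = mobius (dowling0 F #|S| d) V.
Proof.
rewrite -extend_dowling0; apply: mobius_embed => [|U W WU].
  exact: extend_dowling_le.
apply: extend_dowling_surj; apply: subset_trans (suppv_extend U).
exact: suppvS.
Qed.

(** Extension by 0 identifies the lattice on #|S| coordinates with the
    elements supported in S, a downward closed set. *)
Lemma whitney_restrict i :
  \sum_(U : dowling F n d | (\dim U == i) && (suppv U \subset S))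
    mobius (dowling0 F n d) U = whitney F #|S| d i.
Proof.
rewrite (sum_injective_image (f := extend_dowling)).
- apply: eq_big => [V|V _]; last exact: mobius_extend.
  by rewrite /= dim_extend suppv_extend andbT.
- exact: inc_inj extend_dowling_le.
by move=> U /andP[_ /extend_dowling_surj].
Qed.

End Extension.

Section Inversion.
Variables (F : finFieldType) (n d i : nat).

Definition whitney_supp (u : nat) : int :=
  \sum_(U : dowling F n d | (\dim U == i) && (#|suppv U| == u))
    mobius (dowling0 F n d) U.

(** Complements of such S are the subsets of size n - t of the complement of
    A. This form of the binomial coefficient is 0 when A has more than t
    elements. *)
Lemma card_supersets (A : {set 'I_n}) t : (t <= n)%N ->
  #|[set S : {set 'I_n} | A \subset S & #|S| == t]| = 'C(n - #|A|, n - t).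
Proof.
move=> tn; have cA : (#|~: A| = n - #|A|)%N by rewrite cardsCs setCK card_ord.
rewrite -cA -cards_draws -(card_imset _ (@setC_inj _)); apply: eq_card => S.
rewrite inE; apply/imsetP/andP => [[B]|[SA cS]].
  rewrite inE => /andP[AB /eqP cB] ->; rewrite setCS AB cardsCs setCK card_ord cB.
  by rewrite eqxx.
exists (~: S); last by rewrite setCK.
by rewrite inE -setCS setCK SA cardsCs setCK card_ord (eqP cS) subKn /=.
Qed.

Lemma ltn_card_suppv (U : {vspace 'rV[F]_n}) : (#|suppv U| < n.+1)%N.
Proof. by rewrite ltnS; have := max_card (suppv U); rewrite card_ord. Qed.

Lemma whitney_sum_supp :
  whitney F n d i = \sum_(u < n.+1) whitney_supp u.
Proof.
rewrite /whitney (partition_big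
  (fun U : dowling F n d => inord #|suppv U| : 'I_n.+1) predT) //=.
apply: eq_bigr => u _; apply: eq_bigl => U.
by rewrite -val_eqE /= inordK ?ltn_card_suppv.
Qed.

(** Both sides count, with weight mu(0, U), the pairs of a U of rank i and a
    set of t coordinates that contains the support of U. *)
Lemma bin_whitney t : (t <= n)%N ->
  'C(n, t)%:Z * whitney F t d i
    = \sum_(u < n.+1) 'C(n - u, n - t)%:Z * whitney_supp u.
Proof.
move=> tn.
transitivity (\sum_(S : {set 'I_n} | #|S| == t) whitney F #|S| d i).
  rewrite (eq_bigr (fun=> whitney F t d i)) => [|S /eqP -> //].
  have := card_draws 'I_n t; rewrite card_ord cardsE => cS.
  by rewrite sumr_const [#|_|]cS -mulr_natl natz.
under eq_bigr do rewrite -whitney_restrict.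
rewrite (exchange_big_dep (fun U : dowling F n d => \dim U == i)) /=; last first.
  by move=> S U _ /andP[].
transitivity (\sum_(U : dowling F n d | \dim U == i)
   'C(n - #|suppv U|, n - t)%:Z * mobius (dowling0 F n d) U).
  apply: eq_bigr => U ->; rewrite -card_supersets // -natz mulr_natl -sumr_const.
  by apply: eq_bigl => S; rewrite inE andbC.
rewrite (partition_big
  (fun U : dowling F n d => inord #|suppv U| : 'I_n.+1) predT) //=.
apply: eq_bigr => u _; rewrite big_distrr /=.
apply: eq_big => [U|U /andP[_ /eqP <-]].
  by rewrite -val_eqE /= inordK ?ltn_card_suppv.
by rewrite inordK ?ltn_card_suppv.
Qed.

Lemma whitney_supp0 u : (i * d < u)%N -> whitney_supp u = 0.
Proof.
move=> du; rewrite /whitney_supp big_pred0 // => U.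
apply/andP => -[/eqP dU /eqP cU].
by have := card_suppv_dowling U; rewrite dU cU leqNgt du.
Qed.

Lemma whitney_dim0 : (n < i)%N -> whitney F n d i = 0.
Proof.
move=> ni; rewrite /whitney big_pred0 // => U; apply/eqP => dU.
by have := dimvS (subvf U); rewrite dU dimvf /dim /= mul1n leqNgt ni.
Qed.

End Inversion.

(** Substitute [bin_whitney], exchange the sums, and the inner sum over t is
    the one of [bin_inversion]. *)
Lemma whitney_low_part (F : finFieldType) (n i d : nat) : (i * d <= n)%N ->
  \sum_(i <= t < i * d) 'C(n, t)%:Z * whitney F t d i *
        (\sum_(t <= s < i * d) 'C(n - t, n - s)%:Z * (-1) ^+ (s - t))
  = \sum_(s < i * d) whitney_supp F n d i s.
Proof.
move=> hid; set N := (i * d)%N in hid *.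
rewrite big_geq_mkord /= big_mkcond /=.
transitivity (\sum_(t < N) \sum_(s < N | (t <= s)%N) \sum_(u < n.+1)
   'C(n - t, n - s)%:Z * (-1) ^+ (s - t) * 'C(n - u, n - t)%:Z * whitney_supp F n d i u).
  (* The sum over t may start at 0, because there is no subspace of
     dimension i in fewer than i coordinates. *)
  apply: eq_bigr => t _; case: leqP => it; last first.
    apply/esym/big1 => s _.
    under eq_bigr do rewrite -mulrA.
    rewrite -big_distrr -bin_whitney /=; last first.
      by rewrite ltnW // (leq_trans (ltn_ord t)).
    by rewrite whitney_dim0 ?mulr0.
  rewrite big_geq_mkord big_distrr /=; apply: eq_bigr => s _.
  rewrite bin_whitney; last by rewrite ltnW // (leq_trans (ltn_ord t)).
  by rewrite mulrC big_distrr /=; apply: eq_bigr => u _; rewrite mulrA.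
rewrite (exchange_big_dep predT) //=; apply: eq_bigr => s _.
have sn : (s < n)%N := leq_trans (ltn_ord s) hid.
rewrite exchange_big /= (bigD1 (inord s)) //= -big_distrl /=.
have inv (u : 'I_n.+1) : \sum_(t < N | (t <= s)%N)
    'C(n - t, n - s)%:Z * (-1) ^+ (s - t) * 'C(n - u, n - t)%:Z
  = (u == s :> nat)%:Z.
  have un : (u <= n)%N by rewrite -ltnS.
  rewrite -(bin_inversion un (ltnW sn)).
  by rewrite (big_ord_widen_cond N predT
    (fun t => 'C(n - t, n - s)%:Z * (-1) ^+ (s - t) * 'C(n - u, n - t)%:Z)
    (ltn_ord s)).
rewrite inv inordK ?eqxx ?mul1r; last exact: ltnW.
rewrite big1 ?addr0 // => u us; rewrite -big_distrl /= inv.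
have -> : (u == s :> nat) = false.
  by apply: contraNF us => /eqP us; apply/eqP/val_inj; rewrite /= inordK // ltnW.
by rewrite mul0r.
Qed.

Lemma whitney_supp_top (F : finFieldType) (n i d : nat) : (0 < d)%N ->
  whitney_supp F n d i (i * d)
  = (-1) ^+ i * #|framed_subspaces d i (fullv : {vspace 'rV[F]_n})|%:Z.
Proof.
move=> d0; have q1 : (1 < #|F|)%N := card_finNzRing_gt1 F.
rewrite /whitney_supp -(card_framed_dowling d0) -natz mulr_natr -sumr_const.
apply: eq_big => U; last first.
  move=> /andP[/eqP dU cU].
  by rewrite (mobius_framed d0 q1) ?dU // (framed_card d0) dU.
rewrite inE subvf (framed_card d0) andbC /=.
by case: (\dim U =P i) => [->|]; rewrite ?andbF.
Qed.

Theorem theorem6p1 (q : nat) (F : finFieldType) (hq : #|F| = q)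
    (n i d : nat) (hn : (1 <= n)%N) (hi : (1 <= i)%N) (hd : (1 <= d)%N)
    (hin : (i <= n)%N) (hid : (i * d <= n)%N) :
  whitney F n d i =
    (-1) ^+ i * (q%:Z - 1) ^+ (i * (d - 1)) *
      (\sum_(l : {ffun 'I_i -> 'I_n.+1} |
           [forall j : 'I_i, 1 <= l j <= n - d + 1]%N &&
           [forall j : 'I_i, forall k : 'I_i, (j < k)%N ==> (l j < l k)%N])
         \prod_(j < i)
           (binz (n%:Z - (l j)%:Z - d%:Z * (i%:Z - j.+1%:Z)) (d - 1))%:Z)
    + \sum_(i <= t < i * d)
        'C(n, t)%:Z * whitney F t d i *
        (\sum_(t <= s < i * d) 'C(n - t, n - s)%:Z * (-1) ^+ (s - t)).
Proof.
rewrite whitney_low_part // whitney_sum_supp addrC.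
rewrite -(big_mkord predT (whitney_supp F n d i)).
rewrite (big_cat_nat (n := i * d)%N) //=; last exact: leqW.
rewrite big_mkord; congr (_ + _).
rewrite big_ltn ?ltnS // big_nat big1 ?addr0 => [|u /andP[idu _]]; last first.
  exact: whitney_supp0.
rewrite whitney_supp_top // -mulrA; congr (_ * _).
case: d hd hid => // d _ hid; rewrite subSS subn0.
have dn : (d < n)%N by apply: leq_trans hid; rewrite leq_pmull.
pose w k l := binz (n%:Z - l%:Z - d.+1%:Z * k%:Z) d.
have -> : (n - d.+1 + 1 = n - d)%N by lia.
transitivity (((#|F| - 1) ^ (i * d) * chain_sum w (n - d) i 0)%N : int).
  congr Posz; apply/eqP; rewrite -(eqn_pmul2l (fact_gt0 i)).
  rewrite card_framed_full ?card_finNzRing_gt1 // mulnCA chain_sum_draws //.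
  by rewrite subn0 subSS subn0 mulnC.
rewrite PoszM -hq; congr (_ * _).
  rewrite -natz natrX natz; congr (_ ^+ _).
  by rewrite subzn // ltnW ?card_finNzRing_gt1.
rewrite -(sum_chains w i 0 (leq_subr d n)) -natz natr_sum; apply: eq_bigr => l _.
rewrite natr_prod; apply: eq_bigr => j _; rewrite natz /w.
by rewrite -(subzn (ltn_ord j)).
Qed.
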